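(* Let $G\colon\mathcal{E}\to\mathrm{Sym}_{++}(n)$, $X\mapsto G_X=G(X)$, be smooth, and endow $\mathcal{E}$ with the Riemannian metric $\langle\xi,\eta\rangle_X=\mathrm{tr}(\xi^\top G_X\eta)$ for $\xi,\eta\in T_X\mathcal{E}=\mathbb{R}^{n\times p}$, $X\in\mathcal{E}$. Let $\bar\nabla$ be the Levi-Civita connection of this Riemannian manifold. Let $X\in\mathcal{E}$ and let $\bar U,\bar V$ be smooth vector fields on $\mathcal{E}$ with $\bar U(X)=\xi$ and $\bar V(X)=\eta$. Then $$(\bar\nabla_{\bar U}\bar V)(X)=\mathrm{D}\bar V(X)[\xi]+\Gamma_X(\xi,\eta),$$ where $$\Gamma_X(\xi,\eta)=\frac12\Big(G_X^{-1}\big(\mathrm{D}G(X)[\xi]\,\eta+\mathrm{D}G(X)[\eta]\,\xi\big)-\mathrm{D}G(X)^*[\mathrm{sym}(\xi\eta^\top)]\Big),$$ and $\mathrm{D}G(X)^*\colon\mathrm{Sym}(n)\to\mathbb{R}^{n\times p}$ is the adjoint of $\mathrm{D}G(X)\colon\mathbb{R}^{n\times p}\to\mathrm{Sym}(n)$ with respect to the inner product $\langle\cdot,\cdot\rangle_X$ on $\mathbb{R}^{n\times p}$ and the standard inner product on $\mathrm{Sym}(n)$, i.e. $\langle\mathrm{D}G(X)^*[S],\zeta\rangle_X=\mathrm{tr}(S\,\mathrm{D}G(X)[\zeta])$ for all $\zeta\in\mathbb{R}^{n\times p}$ and $S\in\mathrm{Sym}(n)$.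
   Context: $p\le n$ are positive integers and $A$ is a real symmetric invertible $n\times n$ matrix. $\mathcal{E}$ is the open subset (open submanifold) of $\mathbb{R}^{n\times p}$ consisting of all $X$ with $\det(X^\top X)\ne0$ and $\det(X^\top AX)\neq0$; its tangent space at every point is identified with $\mathbb{R}^{n\times p}$, and vector fields on $\mathcal{E}$ are regarded as maps $\mathcal{E}\to\mathbb{R}^{n\times p}$. $\mathrm{Sym}(n)$ (resp. $\mathrm{Sym}_{++}(n)$) is the set of real symmetric (resp. symmetric positive-definite) $n\times n$ matrices. $\mathrm{sym}(S)=(S+S^\top)/2$. $\mathrm{D}\bar V(X)[\xi]=\lim_{t\to0}(\bar V(X+t\xi)-\bar V(X))/t$ and $\mathrm{D}G(X)[\xi]=\lim_{t\to0}(G(X+t\xi)-G(X))/t$ are ordinary directional derivatives. *)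

(* Defs.v *)
From HB Require Import structures.
From mathcomp Require Import all_boot all_order all_algebra.
From mathcomp Require Import all_classical all_reals all_analysis.

Set Implicit Arguments.
Unset Strict Implicit.
Unset Printing Implicit Defensive.

Import Order.TTheory GRing.Theory Num.Theory.
Import numFieldNormedType.Exports.

Local Open Scope classical_set_scope.
Local Open Scope ring_scope.

(* Functions, vector fields and tensors on an open set E of 'M[R]_(n, p) are
   represented by total functions on 'M[R]_(n, p) of which only the values on E
   matter. 'D_xi F X is the limit of h^-1 *: (F (h *: xi + X) - F X) as h
   tends to 0, so for X in the open set E it depends on F only through its
   restriction to E. *)

(* F is C^k on the open set E. As the domain is finite-dimensional, the
   differential of F is C^k if and only if all its evaluations 'D_v F are. *)
Fixpoint Ck_on (R : realType) (n p : nat) (W : normedModType R) (k : nat)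
    (E : set 'M[R]_(n, p)) (F : 'M[R]_(n, p) -> W) : Prop :=
  match k with
  | 0%N => forall X, E X -> {for X, continuous F}
  | k'.+1 => (forall X, E X -> differentiable F X) /\
             (forall v : 'M[R]_(n, p), Ck_on k' E ('D_v F))
  end.

Definition smooth_on (R : realType) (n p : nat) (W : normedModType R)
    (E : set 'M[R]_(n, p)) (F : 'M[R]_(n, p) -> W) : Prop :=
  forall k, Ck_on k E F.

(* The derivation defined by the vector field U: (U f)(X) = D f(X)[U(X)]. *)
Definition vf_deriv (R : realType) (n p : nat)
    (U : 'M[R]_(n, p) -> 'M[R]_(n, p)) (f : 'M[R]_(n, p) -> R)
    : 'M[R]_(n, p) -> R :=
  fun X => 'D_(U X) f X.

(* That nabla U V on E depends only on the restrictions of U and V to E is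
   not required separately: if W vanishes on E then f W = W for f the indicator
   function of the complement of E, which vanishes on E and is thus smooth on E,
   so nabla W V and nabla U W vanish on E by linearity and the Leibniz rule. *)
Record affine_connection (R : realType) (n p : nat) (E : set 'M[R]_(n, p))
    (nabla : ('M[R]_(n, p) -> 'M[R]_(n, p)) ->
             ('M[R]_(n, p) -> 'M[R]_(n, p)) ->
             ('M[R]_(n, p) -> 'M[R]_(n, p))) : Prop := {
  connection_smooth : forall U V,
    smooth_on E U -> smooth_on E V -> smooth_on E (nabla U V);
  connection_linearl : forall (f g : 'M[R]_(n, p) -> R) U U' V,
    smooth_on E f -> smooth_on E g ->
    smooth_on E U -> smooth_on E U' -> smooth_on E V ->
    forall X, E X ->
      nabla (fun Y => f Y *: U Y + g Y *: U' Y) V X =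
      f X *: nabla U V X + g X *: nabla U' V X;
  connection_linearr : forall (a b : R) U V V',
    smooth_on E U -> smooth_on E V -> smooth_on E V' ->
    forall X, E X ->
      nabla U (fun Y => a *: V Y + b *: V' Y) X =
      a *: nabla U V X + b *: nabla U V' X;
  connection_leibniz : forall (f : 'M[R]_(n, p) -> R) U V,
    smooth_on E f -> smooth_on E U -> smooth_on E V ->
    forall X, E X ->
      nabla U (fun Y => f Y *: V Y) X =
      vf_deriv U f X *: V X + f X *: nabla U V X }.

(* [U, V] = nabla_U V - nabla_V U, both sides acting as derivations on smooth
   functions, where [U, V] f = U (V f) - V (U f). *)
Definition torsion_free (R : realType) (n p : nat) (E : set 'M[R]_(n, p))
    (nabla : ('M[R]_(n, p) -> 'M[R]_(n, p)) ->
             ('M[R]_(n, p) -> 'M[R]_(n, p)) ->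
             ('M[R]_(n, p) -> 'M[R]_(n, p))) : Prop :=
  forall U V (f : 'M[R]_(n, p) -> R),
    smooth_on E U -> smooth_on E V -> smooth_on E f ->
    forall X, E X ->
      vf_deriv U (vf_deriv V f) X - vf_deriv V (vf_deriv U f) X =
      vf_deriv (fun Y => nabla U V Y - nabla V U Y) f X.

Definition metric_compatible (R : realType) (n p : nat)
    (E : set 'M[R]_(n, p))
    (g : 'M[R]_(n, p) -> 'M[R]_(n, p) -> 'M[R]_(n, p) -> R)
    (nabla : ('M[R]_(n, p) -> 'M[R]_(n, p)) ->
             ('M[R]_(n, p) -> 'M[R]_(n, p)) ->
             ('M[R]_(n, p) -> 'M[R]_(n, p))) : Prop :=
  forall U V W,
    smooth_on E U -> smooth_on E V -> smooth_on E W ->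
    forall X, E X ->
      vf_deriv U (fun Y => g Y (V Y) (W Y)) X =
      g X (nabla U V X) (W X) + g X (V X) (nabla U W X).

Definition is_levi_civita (R : realType) (n p : nat)
    (E : set 'M[R]_(n, p))
    (g : 'M[R]_(n, p) -> 'M[R]_(n, p) -> 'M[R]_(n, p) -> R)
    (nabla : ('M[R]_(n, p) -> 'M[R]_(n, p)) ->
             ('M[R]_(n, p) -> 'M[R]_(n, p)) ->
             ('M[R]_(n, p) -> 'M[R]_(n, p))) : Prop :=
  [/\ affine_connection E nabla, torsion_free E nabla &
      metric_compatible E g nabla].

Definition posdefmx (R : realType) (n : nat) (S : 'M[R]_n) : Prop :=
  S^T = S /\ (forall v : 'cV[R]_n, v != 0 -> 0 < \tr (v^T *m S *m v)).

Definition symmx (R : realType) (n : nat) (S : 'M[R]_n) : 'M[R]_n :=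
  2^-1 *: (S + S^T).

Definition calE (R : realType) (n p : nat) (A : 'M[R]_n)
    : set 'M[R]_(n, p) :=
  [set X | \det (X^T *m X) != 0 /\ \det (X^T *m A *m X) != 0].

Definition metric (R : realType) (n p : nat) (G : 'M[R]_(n, p) -> 'M[R]_n)
    (X xi eta : 'M[R]_(n, p)) : R :=
  \tr (xi^T *m G X *m eta).

(* DG(X)^*[S], characterised by its defining property; for symmetric S, which
   is the only relevant case, such a matrix exists and is unique when X is in
   an open set on which G is smooth and positive-definite. *)
Definition DG_adjoint (R : realType) (n p : nat)
    (G : 'M[R]_(n, p) -> 'M[R]_n) (X : 'M[R]_(n, p)) (S : 'M[R]_n)
    : 'M[R]_(n, p) :=
  xget 0 [set Z | forall zeta : 'M[R]_(n, p),
                    metric G X Z zeta = \tr (S *m 'D_zeta G X)].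

Definition Gamma (R : realType) (n p : nat) (G : 'M[R]_(n, p) -> 'M[R]_n)
    (X xi eta : 'M[R]_(n, p)) : 'M[R]_(n, p) :=
  2^-1 *: (invmx (G X) *m ('D_xi G X *m eta + 'D_eta G X *m xi)
           - DG_adjoint G X (symmx (xi *m eta^T))).

(* Main.v *)
Require Import Defs.
From mathcomp Require Import all_boot all_order all_algebra.
From mathcomp Require Import all_classical all_reals all_analysis.
Import numFieldNormedType.Exports.
Local Open Scope classical_set_scope.
Local Open Scope ring_scope.
From mathcomp Require Import lra.
Import Order.TTheory GRing.Theory Num.Theory.

Set Implicit Arguments.
Unset Strict Implicit.
Unset Printing Implicit Defensive.

(** The formula is the Koszul formula, read against a constant test field.
    Let W be the constant field zeta. Adding the metric compatibility
    identities for D_U g(V, W) and D_V g(U, W), subtracting the one for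
    D_W g(U, V), and using that the torsion vanishes leaves an expression for
    2 g(nabla_U V, zeta) in which the only derivatives left are those of U, V
    and of the metric. As D W = 0, the derivatives of U cancel, those of V
    collapse to 2 g(DV[xi], zeta), and what remains is
      tr(eta^T DG[xi] zeta) + tr(xi^T DG[eta] zeta) - tr(xi^T DG[zeta] eta)
    (lemma [koszul]). The right-hand side of the theorem has the same pairing
    with zeta: the two G^-1 terms give the first two traces because DG[v] is
    symmetric, and the adjoint term gives the third one by its defining
    property, which makes sense because the linear form
    zeta |-> tr(S DG[zeta]) is represented by a matrix for g_X (lemmas
    [metric_DG_adjoint] and [metric_Gamma]). Since g_X is nondegenerate, the
    two matrices agree.

    Torsion-freeness is phrased on functions; testing it on the coordinate
    functions turns it into nabla_U V - nabla_V U = DV[U] - DU[V]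
    (lemma [torsion_freeE]). *)

(** * Differentiating matrix-valued maps *)

Lemma is_derive_mxP (R : realType) (V : normedModType R) (m n : nat)
    (M : V -> 'M[R]_(m, n)) (dM : 'M[R]_(m, n)) (x v : V) :
  is_derive x v M dM <->
  forall i j, is_derive x v (fun y => M y i j) (dM i j).
Proof.
split=> [[dMx <-] i j|H].
  by split; [exact: (derivable_mxP _ _ _).1|rewrite derive_mx// mxE].
have dMx : derivable M x v.
  by apply/derivable_mxP => i j; have [] := H i j.
split=> //; rewrite derive_mx//; apply/matrixP => i j; rewrite mxE.
by have [_ ->] := H i j.
Qed.

Lemma is_derive_trmx (R : realType) (V : normedModType R) (m n : nat)
    (M : V -> 'M[R]_(m, n)) (dM : 'M[R]_(m, n)) (x v : V) :
  is_derive x v M dM -> is_derive x v (fun y => (M y)^T) dM^T.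
Proof.
move=> /is_derive_mxP H; apply/is_derive_mxP => i j.
by under eq_fun do rewrite mxE; rewrite mxE.
Qed.

Lemma is_derive_mulmx (R : realType) (V : normedModType R) (m n q : nat)
    (M : V -> 'M[R]_(m, n)) (N : V -> 'M[R]_(n, q)) (dM : 'M[R]_(m, n))
    (dN : 'M[R]_(n, q)) (x v : V) :
  is_derive x v M dM -> is_derive x v N dN ->
  is_derive x v (fun y => M y *m N y) (dM *m N x + M x *m dN).
Proof.
move=> /is_derive_mxP HM /is_derive_mxP HN; apply/is_derive_mxP => i j.
have := is_derive_sum (fun k => is_deriveM (HM i k) (HN k j)).
rewrite (_ : \sum_(k < n) _ = fun y => (M y *m N y) i j); last first.
  by apply/funext => y; rewrite fct_sumE mxE.
move=> H; apply: (is_derive_eq H); rewrite !mxE -big_split/=.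
by apply: eq_bigr => k _; rewrite /GRing.scale/= addrC [N x k j * _]mulrC.
Qed.

Lemma is_derive_mxtrace (R : realType) (V : normedModType R) (n : nat)
    (M : V -> 'M[R]_n) (dM : 'M[R]_n) (x v : V) :
  is_derive x v M dM -> is_derive x v (fun y => \tr (M y)) (\tr dM).
Proof.
move=> /is_derive_mxP H; have := is_derive_sum (fun k => H k k).
by rewrite (_ : \sum_(k < n) _ = fun y => \tr (M y))//;
  apply/funext => y; rewrite fct_sumE.
Qed.

Lemma derive_linear (R : realType) (V W : normedModType R) (f : V -> W) (x : V)
    (a : R) (u v : V) :
  differentiable f x -> 'D_(a *: u + v) f x = a *: 'D_u f x + 'D_v f x.
Proof. by move=> df; rewrite !deriveE// linearP. Qed.

(** * Smooth maps and torsion *)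

Lemma smooth_on_cst (R : realType) (n p : nat) (W : normedModType R)
    (E : set 'M[R]_(n, p)) (c : W) : smooth_on E (cst c).
Proof.
move=> k; elim: k c => [|k IH] c /=; first by move=> X _; exact: cst_continuous.
split=> [X _|v]; first exact: differentiable_cst.
by rewrite (_ : 'D_v _ = cst 0)//; apply/funext => X; rewrite derive_cst.
Qed.

Lemma derive_coord (R : realType) (n p : nat) (i : 'I_n) (j : 'I_p)
    (v X : 'M[R]_(n, p)) : 'D_v (fun Y : 'M[R]_(n, p) => Y i j) X = v i j.
Proof.
by have /is_derive_mxP/(_ i j)[] := is_derive_id X v.
Qed.

Lemma smooth_on_coord (R : realType) (n p : nat) (E : set 'M[R]_(n, p))
    (i : 'I_n) (j : 'I_p) : smooth_on E (fun Y : 'M[R]_(n, p) => Y i j : R).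
Proof.
case=> [|k] /=; first by move=> X _; exact: coord_continuous.
split=> [X _|v]; first exact: differentiable_coord.
rewrite (_ : 'D_v _ = cst (v i j)); first exact: smooth_on_cst.
by apply/funext => X; rewrite derive_coord.
Qed.

Lemma smooth_on_differentiable (R : realType) (n p : nat)
    (W : normedModType R) (E : set 'M[R]_(n, p)) (F : 'M[R]_(n, p) -> W) X :
  smooth_on E F -> E X -> differentiable F X.
Proof. by move=> /(_ 1%N)[/(_ X)]. Qed.

Lemma smooth_on_is_derive (R : realType) (n p : nat)
    (W : normedModType R) (E : set 'M[R]_(n, p)) (F : 'M[R]_(n, p) -> W) X v :
  smooth_on E F -> E X -> is_derive X v F ('D_v F X).
Proof.
move=> sF EX; apply/derivableP/diff_derivable.
exact: smooth_on_differentiable sF EX.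
Qed.

(** A tangent vector is determined by its action on the coordinate functions,
    and these turn the commutator into a difference of first derivatives: a
    field W maps the coordinate Y_ij to the entry W_ij, so the (i, j) entry of
    the identity is U (V_ij) - V (U_ij). *)
Lemma torsion_freeE (R : realType) (n p : nat) (E : set 'M[R]_(n, p)) nabla
    (U V : 'M[R]_(n, p) -> 'M[R]_(n, p)) X :
  torsion_free E nabla -> smooth_on E U -> smooth_on E V -> E X ->
  nabla U V X - nabla V U X = 'D_(U X) V X - 'D_(V X) U X.
Proof.
move=> tf sU sV EX; apply/matrixP => i j.
have vfE W : vf_deriv W (fun Y => Y i j : R) = fun Y => W Y i j.
  by apply/funext => Y; rewrite /vf_deriv derive_coord.
have := tf U V _ sU sV (@smooth_on_coord R n p E i j) X EX.
rewrite !vfE /vf_deriv !mxE => <-.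
have /is_derive_mxP/(_ i j)[_ ->] := smooth_on_is_derive (U X) sV EX.
by have /is_derive_mxP/(_ i j)[_ ->] := smooth_on_is_derive (V X) sU EX.
Qed.

(** * The metric and the adjoint of the derivative of G *)

Section Metric.
Context (R : realType) (n p : nat).
Implicit Types (G : 'M[R]_(n, p) -> 'M[R]_n) (X Y Z : 'M[R]_(n, p)).

Lemma mxtrace_tr_form (S : 'M[R]_n) Y Z : \tr (Y^T *m S *m Z) = \tr (Z^T *m S^T *m Y).
Proof. by rewrite -mxtrace_tr !trmx_mul trmxK mulmxA. Qed.

Lemma metricC G X Y Z : (G X)^T = G X -> metric G X Y Z = metric G X Z Y.
Proof. by move=> GT; rewrite /metric mxtrace_tr_form GT. Qed.

Lemma metricPl G X a Y Y' Z :
  metric G X (a *: Y + Y') Z = a * metric G X Y Z + metric G X Y' Z.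
Proof.
by rewrite /metric linearP/= !mulmxDl -!scalemxAl mxtraceD mxtraceZ.
Qed.

Lemma metricPr G X a Y Z Z' :
  metric G X Y (a *: Z + Z') = a * metric G X Y Z + metric G X Y Z'.
Proof. by rewrite /metric mulmxDr -scalemxAr mxtraceD mxtraceZ. Qed.

Lemma metricBl G X Y Y' Z :
  metric G X (Y - Y') Z = metric G X Y Z - metric G X Y' Z.
Proof. by rewrite addrC -scaleN1r metricPl mulN1r addrC. Qed.

Lemma metricBr G X Y Z Z' :
  metric G X Y (Z - Z') = metric G X Y Z - metric G X Y Z'.
Proof. by rewrite addrC -scaleN1r metricPr mulN1r addrC. Qed.

Lemma derive_metric G X v (U V : 'M[R]_(n, p) -> 'M[R]_(n, p))
    (dG : 'M[R]_n) (dU dV : 'M[R]_(n, p)) :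
  is_derive X v G dG -> is_derive X v U dU -> is_derive X v V dV ->
  'D_v (fun Y => metric G Y (U Y) (V Y)) X =
  metric G X dU (V X) + \tr ((U X)^T *m dG *m V X) + metric G X (U X) dV.
Proof.
move=> hG /is_derive_trmx hU hV.
have [_ ->] := is_derive_mxtrace
  (is_derive_mulmx (is_derive_mulmx hU hG) hV).
by rewrite mulmxDl !mxtraceD.
Qed.

Lemma mxtrace_mul_delta (M : 'M[R]_(p, n)) i j :
  \tr (M *m delta_mx i j) = M j i.
Proof.
rewrite -(mul_delta_mx (0 : 'I_1)) mulmxA -colE mxtrace_mulC -rowE.
by rewrite [\tr _]big_ord1 !mxE.
Qed.

Lemma mxtrace_mul_inj (M N : 'M[R]_(p, n)) :
  (forall Z, \tr (M *m Z) = \tr (N *m Z)) -> M = N.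
Proof. by move=> MN; apply/matrixP => i j; rewrite -!mxtrace_mul_delta. Qed.

Lemma linear_form_mxtrace (L : 'M[R]_(n, p) -> R) :
  (forall a Y Z, L (a *: Y + Z) = a * L Y + L Z) ->
  exists M : 'M[R]_(p, n), forall Z, L Z = \tr (M *m Z).
Proof.
move=> Llin; have L0 : L 0 = 0.
  by have := Llin (-1) 0 0; rewrite scaler0 addr0 mulN1r addNr.
exists (\matrix_(i, j) L (delta_mx j i)) => Z.
set M := \matrix_(_, _) _.
have eqL (I : Type) (r : seq I) F :
    (forall i, L (F i) = \tr (M *m F i)) ->
    L (\sum_(i <- r) F i) = \tr (M *m \sum_(i <- r) F i).
  move=> LF; elim/big_rec: _ => [|i x _ Lx]; first by rewrite L0 mulmx0 mxtrace0.
  by rewrite -[F i]scale1r Llin Lx mulmxDr scale1r mul1r mxtraceD LF.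
rewrite (matrix_sum_delta Z); apply: (eqL) => i; apply: (eqL) => j.
rewrite -[_ *: _]addr0 Llin L0 !addr0 -scalemxAr mxtraceZ.
by rewrite mxtrace_mul_delta mxE.
Qed.

Lemma posdefmx_unit (S : 'M[R]_n) : posdefmx S -> S \in unitmx.
Proof.
move=> [_ Spos]; rewrite unitmxE unitfE; apply/det0P => -[v v0 vS].
have := Spos v^T; rewrite trmx_eq0 trmxK vS mul0mx mxtrace0 ltxx.
by move=> /(_ v0).
Qed.

Lemma metric_inj G X Y Z : G X \in unitmx ->
  (forall zeta, metric G X Y zeta = metric G X Z zeta) -> Y = Z.
Proof.
move=> Gunit /mxtrace_mul_inj YZ; apply: trmx_inj.
by rewrite -(mulmxK Gunit Y^T) YZ mulmxK.
Qed.

Lemma metric_invmx G X Y Z : posdefmx (G X) ->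
  metric G X (invmx (G X) *m Y) Z = \tr (Y^T *m Z).
Proof.
move=> Gpos; rewrite /metric trmx_mul trmx_inv; have [-> _] := Gpos.
by rewrite mulmxKV// posdefmx_unit.
Qed.

(** The adjoint is a chosen matrix, so its defining property has to be
    supported by an existence proof: if zeta |-> tr(S DG(X)[zeta]) is
    zeta |-> tr(M zeta), then G_X^-1 M^T is a witness. *)
Lemma metric_DG_adjoint G X (S : 'M[R]_n) Z :
  posdefmx (G X) -> differentiable G X ->
  metric G X (DG_adjoint G X S) Z = \tr (S *m 'D_Z G X).
Proof.
move=> Gpos dG.
have [M MP] : exists M : 'M[R]_(p, n),
    forall Z, \tr (S *m 'D_Z G X) = \tr (M *m Z).
  apply: linear_form_mxtrace => a Y Y'.
  by rewrite derive_linear// mulmxDr -scalemxAr mxtraceD mxtraceZ.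
rewrite /DG_adjoint; case: xgetP => [W _ ->//|/(_ (invmx (G X) *m M^T))[]].
by move=> Y; rewrite metric_invmx// trmxK MP.
Qed.
End Metric.

(** * The Koszul formula and the Christoffel term *)

(** Metric compatibility on the constant fields Y, Z gives
    tr(Y^T dG Z) = g(nabla_xi Y, Z) + g(Y, nabla_xi Z), and the right-hand
    side is symmetric in Y and Z because g is symmetric at X. The symmetry of
    dG is thus obtained from G at X alone, without comparing G with its
    transpose on a neighbourhood of X. *)
Lemma is_derive_tr_symmetric (R : realType) (n p : nat)
    (E : set 'M[R]_(n, p)) (G : 'M[R]_(n, p) -> 'M[R]_n) nabla X
    (dG : 'M[R]_n) (xi eta zeta : 'M[R]_(n, p)) :
  metric_compatible E (metric G) nabla -> E X -> (G X)^T = G X ->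
  is_derive X xi G dG ->
  \tr (eta^T *m dG *m zeta) = \tr (zeta^T *m dG *m eta).
Proof.
move=> mc EX GT hG.
have H (Y Z : 'M[R]_(n, p)) : \tr (Y^T *m dG *m Z) =
    metric G X (nabla (cst xi) (cst Y) X) Z +
    metric G X Y (nabla (cst xi) (cst Z) X).
  rewrite -(mc (cst xi) (cst Y) (cst Z))//; try exact: smooth_on_cst.
  rewrite /vf_deriv (derive_metric hG
    (is_derive_cst Y X xi) (is_derive_cst Z X xi)).
  by rewrite /metric !(trmx0, mul0mx, mulmx0, mxtrace0) add0r addr0.
by rewrite !H addrC [in RHS]addrC !(@metricC _ _ _ G X _ eta)//
  !(@metricC _ _ _ G X _ zeta)// addrC.
Qed.

(** With W the constant field zeta, the nabla_U W - nabla_W U and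
    nabla_V W - nabla_W V of the Koszul computation are -DU[zeta] and
    -DV[zeta]; they cancel the derivatives of U and V that D_W g(U, V)
    produces, and nabla_V U is eliminated by the torsion identity for U, V. *)
Lemma koszul (R : realType) (n p : nat)
    (E : set 'M[R]_(n, p)) (G : 'M[R]_(n, p) -> 'M[R]_n) nabla X
    (U V : 'M[R]_(n, p) -> 'M[R]_(n, p)) (dG : 'M[R]_(n, p) -> 'M[R]_n)
    (zeta : 'M[R]_(n, p)) :
  torsion_free E nabla -> metric_compatible E (metric G) nabla ->
  (forall v, is_derive X v G (dG v)) -> E X -> (G X)^T = G X ->
  smooth_on E U -> smooth_on E V ->
  2 * metric G X (nabla U V X - 'D_(U X) V X) zeta =
  \tr ((V X)^T *m dG (U X) *m zeta) +
  \tr ((U X)^T *m dG (V X) *m zeta) -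
  \tr ((U X)^T *m dG zeta *m V X).
Proof.
move=> tf mc hG EX GT sU sV.
have sW : smooth_on E (cst zeta) by exact: smooth_on_cst.
have dcst v : 'D_v (cst zeta) X = 0 by exact: derive_cst.
have dmetric v Y Z : smooth_on E Y -> smooth_on E Z ->
    'D_v (fun T => metric G T (Y T) (Z T)) X =
    metric G X ('D_v Y X) (Z X) + \tr ((Y X)^T *m dG v *m Z X)
    + metric G X (Y X) ('D_v Z X).
  move=> sY sZ; exact: (derive_metric (hG v)
    (smooth_on_is_derive v sY EX) (smooth_on_is_derive v sZ EX)).
have mU := mc _ _ _ sU sV sW X EX.
have mV := mc _ _ _ sV sU sW X EX.
have mW := mc _ _ _ sW sU sV X EX.
rewrite /vf_deriv dmetric// in mU; rewrite /vf_deriv dmetric// in mV.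
rewrite /vf_deriv dmetric// in mW.
have tUV := torsion_freeE tf sU sV EX.
have tUW := torsion_freeE tf sU sW EX.
have tVW := torsion_freeE tf sV sW EX.
rewrite !dcst in mU mV tUW tVW.
rewrite /= in mU mV mW tUV tUW tVW.
(* From here on only bilinearity and symmetry of g at X matter; the vectors
   and scalars are generalized so that the identity becomes linear
   arithmetic. *)
move: mU mV mW tUV tUW tVW.
have := metricC _ _ GT; have := @metricBl _ _ _ G X; have := @metricBr _ _ _ G X.
move: (metric G X) (U X) (V X) => g xi eta.
move: (nabla U V X) (nabla V U X) (nabla U (cst zeta) X) (nabla V (cst zeta) X)
  (nabla (cst zeta) U X) (nabla (cst zeta) V X).
move: ('D_xi V X) ('D_eta U X) ('D_zeta U X) ('D_zeta V X).
move: (\tr (xi^T *m dG zeta *m eta)) (\tr (xi^T *m dG eta *m zeta))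
  (\tr (eta^T *m dG xi *m zeta)) => a b c DV DU DzU DzV UV VU UW VW WU WV.
move=> gBr gBl gC mU mV mW /(congr1 (g^~ zeta)) tUV.
move=> /(congr1 (g eta)) tUW /(congr1 (g xi)) tVW.
have g0 Y : g Y 0 = 0 by rewrite -(subrr Y) gBr subrr.
rewrite /= !(gBr, gBl, g0) in mU mV mW tUV tUW tVW *.
rewrite ?[g _ eta]gC in mU mV mW tUV tUW tVW *.
lra.
Qed.

(** Pairing Gamma with zeta for g_X undoes both G_X^-1 and the adjoint; the
    symmetrization in the argument of the adjoint is invisible because
    dG zeta is symmetric. *)
Lemma metric_Gamma (R : realType) (n p : nat)
    (G : 'M[R]_(n, p) -> 'M[R]_n) (dG : 'M[R]_(n, p) -> 'M[R]_n)
    (X xi eta zeta : 'M[R]_(n, p)) :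
  posdefmx (G X) -> differentiable G X ->
  (forall v, is_derive X v G (dG v)) ->
  (forall v (Y Z : 'M[R]_(n, p)),
    \tr (Y^T *m dG v *m Z) = \tr (Z^T *m dG v *m Y)) ->
  2 * metric G X (Gamma G X xi eta) zeta =
  \tr (eta^T *m dG xi *m zeta) + \tr (xi^T *m dG eta *m zeta) -
  \tr (xi^T *m dG zeta *m eta).
Proof.
move=> Gpos diffG hG dGC.
have dGE v : 'D_v G X = dG v by have [_] := hG v.
have dGl v (Y Z : 'M[R]_(n, p)) :
    \tr ((dG v *m Y)^T *m Z) = \tr (Y^T *m dG v *m Z).
  by rewrite -mxtrace_tr trmx_mul trmxK mulmxA dGC.
have two0 : 2 != 0 :> R by rewrite pnatr_eq0.
have adjE : metric G X (DG_adjoint G X (symmx (xi *m eta^T))) zeta =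
    \tr (xi^T *m dG zeta *m eta).
  rewrite metric_DG_adjoint// dGE /symmx trmx_mul trmxK.
  rewrite -scalemxAl mxtraceZ mulmxDl mxtraceD -!mulmxA.
  rewrite !(mxtrace_mulC _ (_ *m dG zeta)) !mulmxA dGC.
  by rewrite mulrDr ![2^-1 * _]mulrC -splitr.
rewrite /Gamma !dGE -[_ *: _]addr0 metricPl mulrDr mulVKf//.
rewrite metricBl adjE (metric_invmx _ _ Gpos) linearD/= mulmxDl mxtraceD !dGl.
by rewrite /metric trmx0 !mul0mx mxtrace0 mulr0 addr0.
Qed.

Theorem proposition4p1 (R : realType) (n p : nat)
    (hp : (0 < p)%N) (hpn : (p <= n)%N)
    (A : 'M[R]_n) (A_sym : A^T = A) (A_inv : A \in unitmx)
    (G : 'M[R]_(n, p) -> 'M[R]_n)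
    (G_smooth : smooth_on (calE A) G)
    (G_posdef : forall X : 'M[R]_(n, p), calE A X -> posdefmx (G X))
    (nabla : ('M[R]_(n, p) -> 'M[R]_(n, p)) ->
             ('M[R]_(n, p) -> 'M[R]_(n, p)) ->
             ('M[R]_(n, p) -> 'M[R]_(n, p)))
    (nabla_LC : is_levi_civita (calE A) (metric G) nabla)
    (X : 'M[R]_(n, p)) (EX : calE A X)
    (U V : 'M[R]_(n, p) -> 'M[R]_(n, p))
    (U_smooth : smooth_on (calE A) U) (V_smooth : smooth_on (calE A) V)
    (xi eta : 'M[R]_(n, p)) (UX : U X = xi) (VX : V X = eta) :
  nabla U V X = 'D_xi V X + Gamma G X xi eta.
Proof.
have [_ tf mc] := nabla_LC; have Gpos := G_posdef X EX.
have [GT _] := Gpos.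
have diffG := smooth_on_differentiable G_smooth EX.
have [dG hG] : exists dG : 'M[R]_(n, p) -> 'M[R]_n,
    forall v, is_derive X v G (dG v).
  by exists (fun v => 'D_v G X) => v; exact: smooth_on_is_derive G_smooth EX.
have dGC v Y Z := is_derive_tr_symmetric Y Z mc EX GT (hG v).
apply/eqP; rewrite addrC -subr_eq; apply/eqP.
apply: (@metric_inj _ _ _ G X) => [|zeta]; first exact: posdefmx_unit.
have two0 : 2 != 0 :> R by rewrite pnatr_eq0.
apply: (mulfI two0); rewrite (metric_Gamma xi eta zeta Gpos diffG hG dGC).
by rewrite -UX -VX (koszul zeta tf mc hG EX GT U_smooth V_smooth).
Qed.
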